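(* Let $\mathcal{X}$ be a real topological vector space with continuous dual space $\mathcal{X}^{\ast}$, and let $\Gamma$ be a family of Gaussian random vectors in $\mathcal{X}$, each having an expectation $\mathbb{E}[X] \in \mathcal{X}$. For each $X \in \Gamma$ let $C_{X}$ be its covariance operator, given by $$\langle C_{X}\ell, \nu\rangle := \mathbb{E}\big[\langle \ell, X - \mathbb{E}[X]\rangle\,\langle \nu, X - \mathbb{E}[X]\rangle\big], \qquad \ell,\nu \in \mathcal{X}^{\ast}.$$ Let $E := \{\mathbb{E}[X] : X \in \Gamma\}$, let $$\Psi(\nu) := \sup_{X \in \Gamma}\sqrt{\langle C_{X}\nu,\nu\rangle}, \qquad \nu \in \mathcal{X}^{\ast},$$ and let $d_{\perp,\Psi}$ be the corresponding normal distance. Then, for any (measurable) $A \subseteq \mathcal{X}$, $$\sup_{X \in \Gamma}\mathbb{P}[X \in A] \leq \exp\left(-\frac{d_{\perp,\Psi}(E,A)^{2}}{2}\right).$$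
   Context: $\langle \nu, x\rangle$ denotes the dual pairing of $\nu \in \mathcal{X}^{\ast}$ and $x \in \mathcal{X}$; $t_{+} := \max\{t,0\}$. $\mathcal{X}$ carries its Borel $\sigma$-algebra. A random vector $X$ in $\mathcal{X}$ is Gaussian if $\langle \ell, X\rangle$ is a (possibly degenerate) real Gaussian random variable for every $\ell \in \mathcal{X}^{\ast}$. $\mathbb{E}[X]$ denotes an element $m \in \mathcal{X}$ with $\mathbb{E}[\langle \ell, X-m\rangle] = 0$ for all $\ell \in \mathcal{X}^{\ast}$. The covariance operator is regarded as a map $\mathcal{X}^{\ast} \to \mathcal{X}^{\ast\ast}$; only the numbers $\langle C_{X}\ell,\nu\rangle$ matter here. For $p \in \mathcal{X}$, $\nu \in \mathcal{X}^{\ast}$ let $\mathbb{H}_{p,\nu} := \{x \in \mathcal{X} : \langle \nu, x\rangle \leq \langle \nu, p\rangle\}$. For a function $\Psi \colon \mathcal{X}^{\ast} \to [0,+\infty]$ that is positively homogeneous of degree one, the $\Psi$-normal distance from $x \in \mathcal{X}$ to $A \subseteq \mathcal{X}$ is $$d_{\perp,\Psi}(x,A) := \sup\left\{\frac{\langle \nu, x-p\rangle_{+}}{\Psi(\nu)} : p \in \mathcal{X},\ \nu \in \mathcal{X}^{\ast},\ A \subseteq \mathbb{H}_{p,\nu}\right\},$$ with the conventions $0/0 = 0$, $c/0 = +\infty$ for $c > 0$, and $c/(+\infty) = 0$ for finite $c \ge 0$. For sets $B, A \subseteq \mathcal{X}$, $d_{\perp,\Psi}(B,A) := \inf_{b \in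 B} d_{\perp,\Psi}(b,A)$. Also $\exp(-\infty) = 0$. *)

(* Defs.v *)
From HB Require Import structures.
From mathcomp Require Import all_boot all_order all_algebra.
From mathcomp Require Import all_classical all_reals all_analysis.

Set Implicit Arguments.
Unset Strict Implicit.
Unset Printing Implicit Defensive.

Import Order.TTheory GRing.Theory Num.Theory.
Import numFieldNormedType.Exports.

Local Open Scope classical_set_scope.
Local Open Scope ring_scope.

Record dual (R : realType) (V : topologicalLmodType R) := Dual {
  dual_fun :> {scalar V} ;
  dual_continuous : continuous (dual_fun : V -> R)
}.

(* [g_sigma_algebraType] needs a pointed type, and a [topologicalLmodType] is
   not declared as one: [pointed_copy V] is V itself, pointed at 0. *)
Definition pointed_copy (R : realType) (V : topologicalLmodType R) : Type := V.

HB.instance Definition _ (R : realType) (V : topologicalLmodType R) :=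
  Choice.on (pointed_copy V).
HB.instance Definition _ (R : realType) (V : topologicalLmodType R) :=
  isPointed.Build (pointed_copy V) (0 : V).

(* V with its Borel sigma-algebra; as a type, convertible to V *)
Notation borelType V := (@g_sigma_algebraType (pointed_copy V) (@open V)).

Section gaussian.
Context d (Omega : measurableType d) (R : realType) (P : probability Omega R).

(* The degenerate case is separated because [normal_prob mu 0] is by convention
   the uniform law on [0, 1], not the Dirac mass at [mu]. *)
Definition gaussian_variable (Y : Omega -> R) : Prop :=
  measurable_fun setT Y /\
  exists mu sigma : R, forall B : set R, measurable B ->
    P (Y @^-1` B) =
      if sigma == 0 then dirac mu B else normal_prob mu sigma B.

Context (V : topologicalLmodType R).
Implicit Types (X : {RV P >-> borelType V}) (m : V) (l nu : dual V).

Definition gaussian_vector X : Prop :=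
  forall l, gaussian_variable (fun w => l (X w)).

Definition is_expectation X m : Prop :=
  forall l, 'E_P[(fun w => l ((X w : V) - m))%R]%E = 0%E.

(* The number <C_X l, nu> for a random vector X with expectation m *)
Definition cov_form X m l nu : \bar R :=
  'E_P[(fun w => l ((X w : V) - m) * nu ((X w : V) - m))%R]%E.

End gaussian.

Section normal_distance.
Context (R : realType) (V : topologicalLmodType R).
Implicit Types (Psi : dual V -> \bar R) (nu : dual V) (x p : V) (A B : set V).

Definition halfspace p nu : set V := [set x | nu x <= nu p].

(* Division in \bar R follows the required conventions: [0 / 0 = 0],
   [c / 0 = +oo] for [c > 0], and [c / +oo = 0]. *)
Definition normal_distance Psi x A : \bar R :=
  ereal_sup [set t | exists p nu, A `<=` halfspace p nu /\
    t = ((Num.max (nu (x - p)) 0)%:E / Psi nu)%E].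

Definition normal_distance_set Psi B A : \bar R :=
  ereal_inf [set normal_distance Psi b A | b in B].

End normal_distance.

(* Main.v *)
Require Import Defs.
From HB Require Import structures.
From mathcomp Require Import all_boot all_order all_algebra.
From mathcomp Require Import all_classical all_reals all_analysis.
From mathcomp Require Import measurable_realfun ring lra.

Set Implicit Arguments.
Unset Strict Implicit.
Unset Printing Implicit Defensive.

Import Order.TTheory GRing.Theory Num.Theory.
Import numFieldNormedType.Exports.

Local Open Scope classical_set_scope.
Local Open Scope ring_scope.

(**
  If [A] lies in the half-space [nu x <= nu p], then [X] in [A] forces the real
  Gaussian variable [nu X], of mean [nu (E X)] and variance at most
  [Psi nu ^+ 2], to lie at least [nu (E X - p)] below its mean, which has
  probability at most [expR (- q ^+ 2 / 2)] with [q = nu (E X - p) / Psi nu].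
  Optimizing over [p] and [nu] turns [q] into the normal distance.

  The definition of a Gaussian variable only provides a normal density with
  some parameters [m] and [s], which have to be identified with the mean and
  (up to an inequality) the standard deviation. Both are obtained from the total
  mass of the normal density alone: translating it yields the tail bound and the
  moment generating function, hence the mean, and rescaling it yields the
  variance.
*)

(** * Tail, mean and variance of the normal law *)

Section normal_law.
Context (R : realType).
Implicit Types (m s a t : R) (f : R -> \bar R).
Local Notation mu := (@lebesgue_measure R).

(** The Radon-Nikodym derivative and [normal_pdf] have the same integral over every measurable set,
    hence agree almost everywhere. *)
Lemma ge0_integral_normal_prob m s f :
    (forall x, 0 <= f x)%E -> measurable_fun [set: R] f ->
  (\int[normal_prob m s]_x f x = \int[mu]_x (f x * (normal_pdf m s x)%:E))%E.
Proof.
move=> f0 mf.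
have dom := normal_prob_dominates m s.
rewrite -(Radon_Nikodym_SigmaFinite.change_of_variables dom)//.
have intRN := Radon_Nikodym_SigmaFinite.f_integrable dom.
apply: ae_eq_integral => //.
- by apply: emeasurable_funM => //; exact: (measurable_int mu).
- apply: emeasurable_funM => //.
  by apply/measurable_EFinP; exact: measurable_normal_pdf.
- apply: ae_eqe_mul2l; apply: integral_ae_eq => //.
  + by apply/measurable_EFinP; exact: measurable_normal_pdf.
  + by move=> A _ mA; rewrite -Radon_Nikodym_SigmaFinite.f_integral.
Qed.

(** For [x <= m - t], [(x - m) ^+ 2 >= (x - (m - t)) ^+ 2 + t ^+ 2], so the density is at most the
    stated factor times the density centered at [m - t], whose mass is at most 1. *)
Lemma normal_prob_tail m s t : s != 0 -> 0 <= t ->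
  (normal_prob m s [set x | (x <= m - t)%R] <=
   (expR (- (t ^+ 2 / (s ^+ 2 *+ 2))))%:E)%E.
Proof.
move=> s0 t0.
have s2 : 0 < s ^+ 2 by rewrite exprn_even_gt0.
have mA : measurable [set x : R | (x <= m - t)%R] by rewrite -set_itvNyc.
have -> : (expR (- (t ^+ 2 / (s ^+ 2 *+ 2))))%:E =
    ((expR (- (t ^+ 2 / (s ^+ 2 *+ 2))))%:E * 1)%E by rewrite mule1.
apply: (@le_trans _ _ ((expR (- (t ^+ 2 / (s ^+ 2 *+ 2))))%:E *
    normal_prob (m - t) s [set x : R | (x <= m - t)%R])%E); last first.
  by rewrite lee_pmul2l// ?lte_fin ?expR_gt0// probability_le1.
rewrite /normal_prob -ge0_integralZl//; last 2 first.
- by apply/measurable_EFinP/measurable_funTS; exact: measurable_normal_pdf.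
- by move=> x _; rewrite lee_fin normal_pdf_ge0.
apply: ge0_le_integral => //.
- by move=> x _; rewrite lee_fin normal_pdf_ge0.
- by apply/measurable_EFinP/measurable_funTS; exact: measurable_normal_pdf.
- apply/measurable_EFinP/measurable_funTS/measurable_funM => //.
  exact: measurable_normal_pdf.
move=> x /= xt; rewrite lee_fin !normal_pdfE//.
rewrite mulrCA ler_pM2l ?normal_peak_gt0// /normal_fun -expRD ler_expR.
rewrite -[X in _ <= X + _]mulNr -mulrDl ler_pM2r ?invr_gt0 ?pmulrn_lgt0//; nra.
Qed.

Lemma measurable_expR_affine a m :
  measurable_fun [set: R] (fun x => expR (a * (x - m))).
Proof.
apply: measurableT_comp => //; apply: measurable_funM => //.
exact: measurable_funB.
Qed.

(** Completing the square turns the integrand times the density into a constant times the density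
    centered at [m + a * s ^+ 2], which has mass 1. *)
Lemma normal_prob_mgf m s a : s != 0 ->
  (\int[normal_prob m s]_x (expR (a * (x - m)))%:E =
   (expR (a ^+ 2 * s ^+ 2 / 2))%:E)%E.
Proof.
move=> s0.
rewrite ge0_integral_normal_prob//; last first.
  by apply/measurable_EFinP; exact: measurable_expR_affine.
transitivity (\int[mu]_x ((expR (a ^+ 2 * s ^+ 2 / 2))%:E *
    (normal_pdf (m + a * s ^+ 2) s x)%:E))%E.
  apply: eq_integral => x _; rewrite -!EFinM !normal_pdfE// /normal_fun.
  rewrite mulrCA [in RHS]mulrCA -!expRD; do 3 congr (_ _); field.
  by rewrite s0.
rewrite ge0_integralZl//; last 2 first.
- by apply/measurable_EFinP/measurable_funTS; exact: measurable_normal_pdf.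
- by move=> x _; rewrite lee_fin normal_pdf_ge0.
by rewrite integral_normal_pdf mule1.
Qed.

(** [|v| <= expR v + expR (- v)], and both exponentials have finite integral. *)
Lemma normal_prob_integrable m s : s != 0 ->
  (normal_prob m s).-integrable [set: R] (fun x => (x - m)%:E).
Proof.
move=> s0.
apply/integrableP; split; first exact/measurable_EFinP/measurable_funB.
apply: (@le_lt_trans _ _ (\int[normal_prob m s]_x
   ((expR (1 * (x - m)))%:E + (expR (-1 * (x - m)))%:E))%E).
  apply: ge0_le_integral => //.
  - apply/measurable_EFinP/measurableT_comp => //; exact: measurable_funB.
  - by apply: emeasurable_funD; apply/measurable_EFinP;
      exact: measurable_expR_affine.
  move=> x _; rewrite -EFinD abse_EFin lee_fin ler_norml mul1r mulN1r.
  have := expR_ge1Dx (x - m); have := expR_ge1Dx (- (x - m)).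
  have := expR_ge0 (x - m); have := expR_ge0 (- (x - m)).
  by move=> *; apply/andP; split; lra.
rewrite ge0_integralD//.
- by rewrite !normal_prob_mgf// -EFinD ltry.
- by apply/measurable_EFinP; exact: measurable_expR_affine.
- by apply/measurable_EFinP; exact: measurable_expR_affine.
Qed.

(* [1 + v <= expR v] bounds [1 + a * e], for [e] the centered mean, by the
   moment generating function, whose logarithm is quadratic in [a]; hence
   [e = 0]. *)
Lemma normal_prob_mean m s : s != 0 ->
  (\int[normal_prob m s]_x (x - m)%:E = 0)%E.
Proof.
move=> s0; have intx := normal_prob_integrable m s0.
have finx := integrable_fin_num measurableT intx.
rewrite -(fineK finx); set e := fine _.
have eE : (\int[normal_prob m s]_x (x - m)%:E)%E = e%:E by rewrite fineK.
have bnd a : 1 + a * e <= expR (a ^+ 2 * s ^+ 2 / 2).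
  rewrite -lee_fin -(normal_prob_mgf m a s0).
  have -> : (1 + a * e)%:E = (\int[normal_prob m s]_x (1 + a * (x - m))%:E)%E.
    under eq_integral do rewrite EFinD EFinM.
    rewrite integralD//; last 2 first.
    + exact: (@finite_measure_integrable_cst _ _ _ (normal_prob m s) _ 1).
    + exact: integrableZl.
    rewrite integralZl// eE integral_cst//= mul1e.
    by rewrite (@probability_setT _ _ _ (normal_prob m s)).
  apply: le_integral => //.
  - under eq_fun do rewrite EFinD EFinM.
    apply: integrableD => //; last exact: integrableZl.
    exact: (@finite_measure_integrable_cst _ _ _ (normal_prob m s) _ 1).
  - apply/integrableP; split.
      by apply/measurable_EFinP; exact: measurable_expR_affine.
    under eq_integral do rewrite gee0_abs ?lee_fin ?expR_ge0//.
    by rewrite normal_prob_mgf// ltry.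
  - by move=> x _; rewrite lee_fin expR_ge1Dx.
have s2 : 0 < s ^+ 2 by rewrite exprn_even_gt0.
apply/eqP; rewrite eqe; apply/contraT => e0.
have e2 : 0 < e ^+ 2 by rewrite exprn_even_gt0.
(* With [a = e / (s ^+ 2 + e ^+ 2)], [a * e] and the exponent [v] are [q] and
   [p * q / 2] where [p + q = 1]; [expR v <= (1 - v)^-1] then contradicts
   [bnd]. *)
pose p := s ^+ 2 / (s ^+ 2 + e ^+ 2); pose q := e ^+ 2 / (s ^+ 2 + e ^+ 2).
have D0 : s ^+ 2 + e ^+ 2 != 0 by rewrite gt_eqF// addr_gt0.
have p0 : 0 < p by rewrite divr_gt0// addr_gt0.
have q0 : 0 < q by rewrite divr_gt0// addr_gt0.
have pq : p + q = 1 by rewrite -mulrDl divff.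
have := bnd (e / (s ^+ 2 + e ^+ 2)).
have -> : e / (s ^+ 2 + e ^+ 2) * e = q by rewrite /q; field.
have -> : (e / (s ^+ 2 + e ^+ 2)) ^+ 2 * s ^+ 2 / 2 = p * q / 2.
  by rewrite /p /q; field.
set v := p * q / 2 => qv.
have v1 : v < 1 by rewrite /v; nra.
have := expR_ge1Dx (- v).
rewrite expRN -[leRHS]mul1r ler_pdivlMr ?expR_gt0// => ev.
have v1' : 0 <= 1 - v by lra.
have := ler_wpM2l v1' qv.
have pE : p = 1 - q by lra.
have -> : (1 - v) * (1 + q) = 1 + q / 2 + q ^+ 3 / 2 by rewrite /v pE; field.
have := exprn_gt0 3 q0; lra.
Qed.

Lemma normal_peakM r s : 0 < r -> normal_peak (r * s) = normal_peak s / r.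
Proof.
move=> r0; rewrite /normal_peak -invfM; congr (_^-1).
by rewrite exprMn -mulrA -mulrnAr sqrtrM ?sqr_ge0// sqrtr_sqr gtr0_norm// mulrC.
Qed.

(* For [0 < r < 1], [expR (- v) >= 1 - v] compares the density of standard
   deviation [r * s] with that of standard deviation [s]; integrating gives
   [2 * r ^+ 2 * s ^+ 2 <= (1 + r) * w], where [w] is the variance, and [r]
   tends to 1. *)
Lemma normal_prob_variance_ge m s : s != 0 ->
  ((s ^+ 2)%:E <= \int[normal_prob m s]_x ((x - m) ^+ 2)%:E)%E.
Proof.
move=> s0.
have s2 : 0 < s ^+ 2 by rewrite exprn_even_gt0.
have msqr : measurable_fun [set: R] (fun x => ((x - m) ^+ 2)%:E).
  by apply/measurable_EFinP/measurable_funX; exact: measurable_funB.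
have mpdf (c : R) : measurable_fun [set: R] (fun x => (normal_pdf m c x)%:E).
  by apply/measurable_EFinP; exact: measurable_normal_pdf.
have pdf0 (c x : R) : (0 <= (normal_pdf m c x)%:E)%E.
  by rewrite lee_fin normal_pdf_ge0.
set W := (X in (_ <= X)%E).
have W0 : (0 <= W)%E by apply: integral_ge0 => x _; rewrite lee_fin sqr_ge0.
have [Wfin|] := boolP (W \is a fin_num); last first.
  by rewrite ge0_fin_numE// -leNgt leye_eq => /eqP ->; rewrite leey.
rewrite -(fineK Wfin); set w := fine W.
have WE : (\int[mu]_x (((x - m) ^+ 2)%:E * (normal_pdf m s x)%:E))%E = w%:E.
  rewrite -ge0_integral_normal_prob// ?fineK// => x.
  by rewrite lee_fin sqr_ge0.
have bnd (r : R) : 0 < r -> r < 1 -> 2 * r ^+ 2 * s ^+ 2 <= (1 + r) * w.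
  move=> r0 r1; have rn0 : r != 0 by rewrite gt_eqF.
  (* With this [k], [normal_fun m (r * s) x] is [normal_fun m s x] times
     [expR (- (k * (x - m) ^+ 2))]. *)
  pose k := (r ^- 2 - 1) / (s ^+ 2 *+ 2).
  have k0 : 0 <= k.
    rewrite divr_ge0 ?mulrn_wge0 ?sqr_ge0// subr_ge0 invf_ge1 ?exprn_gt0//.
    by rewrite expr_le1// ltW.
  have mprod : measurable_fun [set: R]
      (fun x => ((x - m) ^+ 2)%:E * (normal_pdf m s x)%:E)%E.
    by apply: emeasurable_funM => //; exact: mpdf.
  have mr : measurable_fun [set: R]
      (fun x => r%:E * (normal_pdf m (r * s) x)%:E)%E.
    by apply: emeasurable_funM => //; exact: mpdf.
  have mk : measurable_fun [set: R]
      (fun x => k%:E * (((x - m) ^+ 2)%:E * (normal_pdf m s x)%:E))%E.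
    by apply: emeasurable_funM.
  have rE0 : (0 <= r%:E)%E by rewrite lee_fin ltW.
  have kE0 : (0 <= k%:E)%E by rewrite lee_fin.
  have : 1 <= r + k * w.
    rewrite -lee_fin EFinD EFinM -WE -(integral_normal_pdf m s).
    have -> : r%:E = (\int[mu]_x (r%:E * (normal_pdf m (r * s) x)%:E))%E.
      rewrite ge0_integralZl//; last exact: mpdf.
      by rewrite integral_normal_pdf mule1.
    rewrite -ge0_integralZl//; last first.
      by move=> x _; rewrite mule_ge0// lee_fin sqr_ge0.
    rewrite -ge0_integralD//; last 2 first.
    - by move=> x _; rewrite mule_ge0// lee_fin ltW.
    - by move=> x _; rewrite !mule_ge0// lee_fin// sqr_ge0.
    apply: ge0_le_integral => //.
    - exact: mpdf.
    - exact: emeasurable_funD.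
    move=> x _; rewrite -!EFinM -EFinD lee_fin !normal_pdfE ?mulf_neq0//.
    have -> : normal_fun m (r * s) x =
        normal_fun m s x * expR (- (k * (x - m) ^+ 2)).
      rewrite /normal_fun -expRD; congr expR; rewrite /k; field.
      by rewrite s0 rn0.
    rewrite normal_peakM//.
    set d := normal_peak s; set g := normal_fun m s x.
    have dg : 0 <= d * g by rewrite mulr_ge0 ?normal_peak_ge0 ?normal_fun_ge0.
    have -> : r * (d / r * (g * expR (- (k * (x - m) ^+ 2)))) =
        d * g * expR (- (k * (x - m) ^+ 2)) by field; rewrite rn0.
    have := ler_wpM2l dg (expR_ge1Dx (- (k * (x - m) ^+ 2))).
    rewrite -lerBlDr; apply: le_trans.
    by rewrite le_eqVlt; apply/predU1P; left; ring.
  have D0 : 0 < 2 * r ^+ 2 * s ^+ 2 by rewrite mulr_gt0// mulr_gt0// exprn_gt0.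
  have kE : k * (2 * r ^+ 2 * s ^+ 2) = (1 - r) * (1 + r).
    by rewrite /k; field; rewrite s0 rn0.
  move=> h; rewrite -(ler_pM2l (_ : 0 < 1 - r)); last by rewrite subr_gt0.
  rewrite [leRHS]mulrA -kE [leRHS]mulrAC ler_pM2r//; lra.
rewrite lee_fin leNgt; apply/negP => ws.
have w0 : 0 <= w by rewrite fine_ge0.
pose q := w / s ^+ 2.
have q1 : q < 1 by rewrite ltr_pdivrMr ?mul1r.
have q0 : 0 <= q by rewrite divr_ge0// ltW.
have wE : w = q * s ^+ 2 by rewrite divfK// gt_eqF.
(* A single [r] replaces the limit: at the midpoint of [q] and 1 the bound reads
   [(1 + q) ^+ 2 <= (3 + q) * q], which forces [q >= 1]. *)
have := bnd ((1 + q) / 2).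
rewrite wE [leRHS]mulrA ler_pM2r// => bndq.
have : 2 * ((1 + q) / 2) ^+ 2 <= (1 + (1 + q) / 2) * q by apply: bndq; lra.
nra.
Qed.

End normal_law.

(** * Tail of a real Gaussian variable with given mean and bounded variance *)

Section gaussian_tail.
Context d (Omega : measurableType d) (R : realType) (P : probability Omega R).
Implicit Types (Y : Omega -> R) (m s c k q t : R).

(** Nonnegative functions pass through the distribution of [Y]; positive and negative parts give the
    rest. *)
Lemma integral_normal_law Y m s (f : R -> \bar R) :
    measurable_fun [set: Omega] Y -> measurable_fun [set: R] f ->
    (forall B : set R, measurable B -> P (Y @^-1` B) = normal_prob m s B) ->
  (\int[P]_w f (Y w) = \int[normal_prob m s]_x f x)%E.
Proof.
move=> mY mf law.
pose X : {mfun Omega >-> measurableTypeR R} :=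
  @mfun_Sub _ _ _ (measurableTypeR R) Y (mem_set mY).
have ge0 (g : R -> \bar R) : measurable_fun [set: R] g ->
    (forall x, 0 <= g x)%E ->
    (\int[P]_w g (Y w) = \int[normal_prob m s]_x g x)%E.
  move=> mg g0.
  transitivity (\int[distribution P X]_x g x)%E.
    by rewrite ge0_integral_distribution.
  by apply: eq_measure_integral => B mB _; exact: law.
transitivity (\int[P]_w f^\+ (Y w) - \int[P]_w f^\- (Y w))%E.
  rewrite integralE; congr (_ - _)%E; apply: eq_integral => w _.
  - by rewrite !funeposE.
  - by rewrite !funenegE.
rewrite (ge0 (f^\+)%E)//; last exact: measurable_funepos.
rewrite (ge0 (f^\-)%E)//; last exact: measurable_funeneg.
by rewrite -integralE.
Qed.

(** Here [q] stands for [t / k]; the form [q * k <= t] also covers [k = 0]. *)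
Lemma gaussian_variable_tail Y c k q t :
    gaussian_variable P Y ->
    'E_P[(fun w => Y w - c)%R]%E = 0%E ->
    ('E_P[(fun w => (Y w - c) ^+ 2)%R] <= (k ^+ 2)%:E)%E ->
    0 < t -> 0 <= q -> 0 <= k -> q * k <= t ->
  (P [set w | (Y w <= c - t)%R] <= (expR (- (q ^+ 2 / 2)))%:E)%E.
Proof.
move=> [mY [m [s law]]]; rewrite unlock => mean var t0 q0 k0 qkt.
have mT : measurable [set x : R | x <= c - t] by rewrite -set_itvNyc.
have [s0|s0] := eqVneq s 0.
  (* A Dirac law at [m] has mean [m], so [m = c], and this value misses the half-line up to [c - t]:
     the probability is 0. *)
  rewrite s0 eqxx in law.
  have cm : m = c.
    suff [] : (m - c)%:E = 0%E by move/subr0_eq.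
    rewrite -mean.
    rewrite (ae_eq_integral (cst (m - c)%:E))//.
    - by rewrite integral_cst//= probability_setT mule1.
    - by apply/measurable_EFinP/measurable_funB.
    - exists (Y @^-1` (~` [set m])); split => //.
      + rewrite -[X in measurable X]setTI; apply: mY => //.
        exact: measurableC.
      + apply: etrans (law _ _) _; first exact: measurableC.
        by rewrite diracE memNset//; exact.
      + by move=> w /=; apply: contra_not => -> _.
  rewrite (_ : [set w | _] = Y @^-1` [set x : R | x <= c - t])//.
  rewrite law// diracE memNset ?lee_fin ?expR_ge0//= cm; lra.
rewrite (negbTE s0) in law.
have mB (a : R) : measurable_fun [set: R] (fun x => x - a).
  exact: measurable_funB.
have cm : m = c.
  move: mean.
  rewrite (integral_normal_law (f := fun x => (x - c)%:E) mY _ law); last first.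
    exact/measurable_EFinP.
  have -> : (\int[normal_prob m s]_x (x - c)%:E =
      \int[normal_prob m s]_x ((x - m)%:E + (m - c)%:E))%E.
    by apply: eq_integral => x _; rewrite -EFinD subrKA.
  rewrite integralD//; last 2 first.
  - exact: normal_prob_integrable.
  - exact: (@finite_measure_integrable_cst _ _ _ (normal_prob m s) _ (m - c)).
  rewrite normal_prob_mean// add0e integral_cst//=.
  rewrite (@probability_setT _ _ _ (normal_prob m s)) mule1.
  by move=> [] /subr0_eq.
rewrite -cm in var *.
have sk : s ^+ 2 <= k ^+ 2.
  rewrite -lee_fin (le_trans (normal_prob_variance_ge m s0))//.
  rewrite -(integral_normal_law (f := fun x => ((x - m) ^+ 2)%:E) mY _ law)//.
  exact/measurable_EFinP/measurable_funX.
rewrite (_ : [set w | _] = Y @^-1` [set x : R | x <= m - t])//.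
rewrite law ?cm// -cm (le_trans (normal_prob_tail m s0 (ltW t0)))// lee_fin.
have s2 : 0 < s ^+ 2 by rewrite exprn_even_gt0.
rewrite ler_expR lerN2 ler_pdivlMr ?pmulrn_lgt0//.
have : q ^+ 2 * s ^+ 2 <= t ^+ 2.
  apply: (le_trans (ler_wpM2l (sqr_ge0 q) sk)).
  by rewrite -exprMn ler_sqr ?nnegrE ?mulr_ge0// ltW.
rewrite -mulr_natr; lra.
Qed.

End gaussian_tail.

(** * Half-spaces and the normal distance *)

Lemma normal_distance_ge0 (R : realType) (V : topologicalLmodType R)
    (Psi : dual V -> \bar R) (x : V) (A : set V) :
  (0 <= normal_distance Psi x A)%E.
Proof.
(* The half-space of the zero functional is the whole space, and its quotient is 0 whatever [Psi]
   is. *)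
pose nu0 := Dual (dual_fun := (\0 : {scalar V})) (@cst_continuous V R 0).
apply: ereal_sup_ubound; exists 0, nu0; split; first by move=> y _; exact: lexx.
by rewrite [Num.max _ _]maxxx mul0e.
Qed.

Section gaussian_vector_tail.
Context d (Omega : measurableType d) (R : realType) (P : probability Omega R).
Context (V : topologicalLmodType R) (X : {RV P >-> borelType V}) (m : V).
Context (gaussX : gaussian_vector X) (expX : is_expectation X m).
Context (Psi : dual V -> \bar R)
  (cov_le : forall nu, (sqrte (cov_form X m nu nu) <= Psi nu)%E).

Lemma gaussian_vector_halfspace (A : set (borelType V)) (p : V) nu (q : R) :
    measurable A -> A `<=` halfspace p nu -> 0 <= q ->
    (q%:E <= (Num.max (nu (m - p)) 0)%:E / Psi nu)%E ->
  (P (X @^-1` A) <= (expR (- (q ^+ 2 / 2)))%:E)%E.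
Proof.
move=> mA Ap q0; set t := nu (m - p) => qPsi.
have mXA : measurable (X @^-1` A) by exact: measurable_funPTI.
(* If [t <= 0] or [Psi nu = +oo], the quotient is 0, so [q = 0] and the bound is 1. *)
have triv : q = 0 -> (P (X @^-1` A) <= (expR (- (q ^+ 2 / 2)))%:E)%E.
  by move=> ->; rewrite expr0n/= mul0r oppr0 expR0 probability_le1.
have Psi0 : (0 <= Psi nu)%E by rewrite (le_trans (sqrte_ge0 _) (cov_le nu)).
have [t_le0|t0] := leP t 0.
  apply: triv; apply/eqP; rewrite eq_le q0 andbT -lee_fin (le_trans qPsi)//.
  by rewrite (max_idPr t_le0) mul0e.
rewrite (max_idPl (ltW t0)) in qPsi.
have [Psiy|] := eqVneq (Psi nu) +oo%E.
  apply: triv; apply/eqP; rewrite eq_le q0 andbT -lee_fin (le_trans qPsi)//.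
  by rewrite Psiy invey mule0.
rewrite -ltey -ge0_fin_numE// => /fineK.
set k := fine _ => kE; rewrite -kE in qPsi.
have k0 : 0 <= k by rewrite fine_ge0.
have qkt : q * k <= t.
  have [k0'|kn0] := eqVneq k 0; first by rewrite k0' mulr0 ltW.
  move: qPsi; rewrite inver (negbTE kn0) -EFinM lee_fin.
  by rewrite ler_pdivlMr// lt_def kn0.
have cov0 : (0 <= cov_form X m nu nu)%E.
  by rewrite /cov_form; apply: expectation_ge0 => w; rewrite -expr2 sqr_ge0.
have nuB w : nu ((X w : V) - m) = nu (X w) - nu m by rewrite raddfB.
have mean : 'E_P[(fun w => nu (X w) - nu m)%R]%E = 0%E.
  by rewrite -(expX nu); congr expectation; apply/funext => w; rewrite nuB.
have var : ('E_P[(fun w => (nu (X w) - nu m) ^+ 2)%R] <= (k ^+ 2)%:E)%E.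
  have -> : 'E_P[(fun w => (nu (X w) - nu m) ^+ 2)%R]%E = cov_form X m nu nu.
    by congr expectation; apply/funext => w; rewrite nuB expr2.
  rewrite -(sqr_sqrte cov0) EFin_expe lee_sqr ?inE ?sqrte_ge0//.
  by rewrite kE.
apply: le_trans (gaussian_variable_tail (gaussX nu) mean var t0 q0 k0 qkt).
apply: le_measure; rewrite ?inE//.
  rewrite -[X in measurable X]setTI.
  rewrite (_ : [set w | _] =
      (fun w => nu (X w)) @^-1` `]-oo, nu m - t]%classic).
    by apply: (gaussX nu).1.
  by apply/seteqP; split => w /=; rewrite in_itv.
(* If [X w] is in [A], then [nu (X w) <= nu p = nu m - t]. *)
move=> w /= /Ap; rewrite /halfspace /= /t raddfB/=; lra.
Qed.

(** Every real [q < D] lies below the quotient of some half-space containing [A]; the resulting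
    bounds pass to [D], even if [D = +oo]. *)
Lemma gaussian_vector_prob_le (A : set (borelType V)) (D : \bar R) :
    measurable A -> (0 <= D)%E -> (D <= normal_distance Psi m A)%E ->
  (P (X @^-1` A) <= expeR (- (D ^+ 2 / 2)))%E.
Proof.
move=> mA D0 DA.
have mXA : measurable (X @^-1` A) by exact: measurable_funPTI.
have bnd (q : R) : 0 <= q -> (q%:E < D)%E ->
    (P (X @^-1` A) <= (expR (- (q ^+ 2 / 2)))%:E)%E.
  move=> q0 qD; have := lt_le_trans qD DA; rewrite /normal_distance.
  case/ereal_sup_gt => _ [p [nu [Ap ->]]] /ltW.
  exact: gaussian_vector_halfspace.
(* Once the probability is positive its logarithm can be taken, and [D] turns out to be finite. *)
have [P0|Pn0] := eqVneq (P (X @^-1` A)) 0%E; first by rewrite P0 expeR_ge0.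
have Pfin : P (X @^-1` A) \is a fin_num by rewrite fin_num_measure.
move: bnd Pn0; rewrite -(fineK Pfin); set r := fine _ => bnd rn0.
have r0 : 0 < r by rewrite lt_def fine_ge0 ?andbT//; move: rn0; rewrite eqe.
have r1 : r <= 1 by rewrite -lee_fin fineK// probability_le1.
(* [c] is the value of [q] at which the bound [expR (- (q ^+ 2 / 2))] is [r] *)
pose c := Num.sqrt (- ln r * 2).
have lnr : 0 <= - ln r * 2 by rewrite mulr_ge0// oppr_ge0 ln_le0.
(* A real [q] strictly between [c] and [D] would give [r <= expR (- (q ^+ 2 / 2)) < r]. *)
have Dc : (D <= c%:E)%E.
  rewrite leNgt; apply/negP => cD.
  have [q cq qD] : exists2 q : R, c < q & (q%:E < D)%E.
    case: D cD {D0 DA bnd} => [y|_|//]; last first.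
      by exists (c + 1); rewrite ?ltrDl ?ltry.
    by rewrite lte_fin => cy; exists ((c + y) / 2); rewrite ?lte_fin ?midf_lt.
  have q0 : 0 <= q by rewrite (le_trans (sqrtr_ge0 _) (ltW cq)).
  have := bnd q q0 qD; rewrite lee_fin -ler_ln ?posrE ?expR_gt0// expRK.
  move: cq; rewrite -(ltr_sqr) ?nnegrE ?sqrtr_ge0// sqr_sqrtr//; lra.
have : D \is a fin_num by rewrite ge0_fin_numE// (le_lt_trans Dc) ?ltry.
move=> /fineK Dfin; move: D0 Dc; rewrite -Dfin; set x := fine D => x0 xc.
rewrite -EFin_expe inver pnatr_eq0/= lee_fin.
rewrite -ler_ln ?posrE ?expR_gt0// expRK.
have : x ^+ 2 <= c ^+ 2 by rewrite ler_sqr ?nnegrE ?sqrtr_ge0.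
rewrite sqr_sqrtr//; lra.
Qed.

End gaussian_vector_tail.

(** * Uniform bound over the family *)

Theorem proposition4p1 (R : realType) (V : topologicalLmodType R)
    (I : Type) (d : I -> measure_display)
    (Omega : forall i : I, measurableType (d i))
    (P : forall i : I, probability (Omega i) R)
    (X : forall i : I, {RV (P i) >-> borelType V})
    (m : I -> V)
    (gaussX : forall i : I, gaussian_vector (X i))
    (expX : forall i : I, is_expectation (X i) (m i)) :
  let E : set V := range m in
  let Psi : dual V -> \bar R := fun nu =>
    ereal_sup [set sqrte (cov_form (X i) (m i) nu nu) | i in [set: I]] in
  forall A : set (borelType V), measurable A ->
    (ereal_sup [set P i (X i @^-1` A) | i in [set: I]] <=
     expeR (- (normal_distance_set Psi E A ^+ 2 / 2)))%E.
Proof.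
move=> E Psi A mA; apply: ge_ereal_sup => _ [i _ <-].
have cov_le j nu : (sqrte (cov_form (X j) (m j) nu nu) <= Psi nu)%E.
  by apply: ereal_sup_ubound; exists j.
(* The infimum over [E] serves as [D]: it does not depend on [i] and is at most the distance from
   [m i]. *)
apply: (gaussian_vector_prob_le (gaussX i) (expX i) (cov_le i)) => //.
- apply: le_ereal_inf_tmp => _ [b _ <-].
  exact: normal_distance_ge0.
- by apply: ereal_inf_lbound; exists (m i) => //; exists i.
Qed.
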